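(* Let $\Phi$ be an irreducible reduced root system of rank $r$ with simple roots $\alpha_1,\dots,\alpha_r$, fundamental weights $\varpi_1,\dots,\varpi_r$, simple reflections $\sigma_1,\dots,\sigma_r$, and let $w_0$ be the longest element of its Weyl group. Fix a reduced expression $w_0=\sigma_{i_t}\sigma_{i_{t-1}}\cdots\sigma_{i_1}$ (so $t=\#\Phi^+$), and for $j=1,\dots,t$ let $\beta_j=\sigma_{i_t}\sigma_{i_{t-1}}\cdots\sigma_{i_{j+1}}(\alpha_{i_j})$ (these are the distinct positive roots). Then for every $k\in\{1,\dots,r\}$, \[ \sum_{j:\ i_j=k}\beta_j=\varpi_k-w_0\varpi_k . \]
   Context: The fundamental weights are defined by $2(\varpi_i,\alpha_j)/(\alpha_j,\alpha_j)=\delta_{ij}$ for a $W$-invariant inner product $(\cdot,\cdot)$. *)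

(* Defs.v *)
From HB Require Import structures.
From mathcomp Require Import all_boot all_order all_algebra.
From mathcomp Require Import finmap sesquilinear reals.

Set Implicit Arguments.
Unset Strict Implicit.
Unset Printing Implicit Defensive.

Import Order.TTheory GRing.Theory Num.Theory.
Local Open Scope ring_scope.

Section RootSystems.
Context {R : realType} {V : vectType R}.
Variable form : {dot V for idfun}.

Definition cartan (v a : V) : R := 2 * form v a / form a a.

Definition reflection (a : V) : 'End(V) := linfun (fun v => v - cartan v a *: a).

(* [linfun f] only agrees with [f] when [f] is linear, which is checked here. *)
Lemma reflectionE a v : reflection a v = v - cartan v a *: a.
Proof.
have lin : linear (fun v => v - cartan v a *: a).
  move=> c x y; rewrite /cartan linearPl /= mulrDr mulrDl scalerDl.
  rewrite mulrCA -[c * _ / _]mulrA -scalerA opprD addrACA.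
  by rewrite scalerBr.
pose f0 := fun v => v - cartan v a *: a.
pose fL : {linear V -> V} :=
  HB.pack f0 (GRing.isLinear.Build _ _ _ _ f0 lin).
exact: (lfunE fL).
Qed.

(* Since the reflections are orthogonal for [form], the inner products allowed
   here are exactly those invariant under the Weyl group of [Phi]. *)
Record root_system (Phi : {fset V}) : Prop := RootSystem {
  root_span : <<enum_fset Phi>>%VS = fullv;
  root_neq0 : 0 \notin Phi;
  root_refl : forall a b, a \in Phi -> b \in Phi -> reflection a b \in Phi;
  root_int : forall a b, a \in Phi -> b \in Phi -> cartan b a \is a Num.int
}.

Definition reduced_root_system (Phi : {fset V}) : Prop :=
  forall (a : V) (c : R), a \in Phi -> c *: a \in Phi -> c = 1 \/ c = -1.

Definition irreducible_root_system (Phi : {fset V}) : Prop :=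
  Phi != fset0%fset /\
  forall A B : {fset V}, (A `|` B)%fset = Phi ->
    (forall a b, a \in A -> b \in B -> form a b = 0) ->
    A = fset0%fset \/ B = fset0%fset.

Section Base.
Variables (r : nat) (alpha : r.-tuple V).

Record simple_roots (Phi : {fset V}) : Prop := SimpleRoots {
  simple_root : forall i, tnth alpha i \in Phi;
  simple_basis : basis_of fullv alpha;
  simple_sign : forall b, b \in Phi -> exists c : 'I_r -> nat,
    b = \sum_(i < r) (c i)%:R *: tnth alpha i \/
    b = - \sum_(i < r) (c i)%:R *: tnth alpha i
}.

Definition fundamental_weights (varpi : 'I_r -> V) : Prop :=
  forall i j, 2 * form (varpi i) (tnth alpha j)
              / form (tnth alpha j) (tnth alpha j) = (i == j)%:R.

Definition simple_reflection (i : 'I_r) : 'End(V) := reflection (tnth alpha i).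

(* The letters act in the order in which they are listed: the word
   [:: i_1; ...; i_t] stands for sigma_(i_t) \o ... \o sigma_(i_1). *)
Definition word_prod (s : seq 'I_r) : 'End(V) :=
  foldl (fun w i => (simple_reflection i \o w)%VF) \1%VF s.

Definition has_length (w : 'End(V)) (n : nat) : Prop :=
  (exists2 s : seq 'I_r, size s = n & word_prod s = w) /\
  forall s : seq 'I_r, word_prod s = w -> (n <= size s)%N.

Definition reduced_expression (w : 'End(V)) (s : seq 'I_r) : Prop :=
  word_prod s = w /\ has_length w (size s).

End Base.

(* Reflections are involutions, so the group they generate consists of their
   finite products. *)
Inductive weyl_group (Phi : {fset V}) : 'End(V) -> Prop :=
| weyl_id : weyl_group Phi \1%VF
| weyl_comp (a : V) (w : 'End(V)) :
    a \in Phi -> weyl_group Phi w -> weyl_group Phi (reflection a \o w)%VF.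

Definition longest_element (Phi : {fset V}) (r : nat) (alpha : r.-tuple V)
    (w0 : 'End(V)) : Prop :=
  weyl_group Phi w0 /\
  exists2 m : nat, has_length alpha w0 m &
    forall w n, weyl_group Phi w -> has_length alpha w n -> (n <= m)%N.

(* With the 0-based position [j], [drop j.+1 s] lists the letters coming after
   the one at position [j], that is, those written to its left in the product. *)
Definition word_root (r t : nat) (alpha : r.-tuple V) (s : t.-tuple 'I_r)
    (j : 'I_t) : V :=
  word_prod alpha (drop j.+1 s) (tnth alpha (tnth s j)).

End RootSystems.

(* Main.v *)
(** The identity holds for every word.  Since [sigma_i varpi_k] is
    [varpi_k - alpha_k] if [i = k] and [varpi_k] otherwise, stripping the letter
    [i_1] that acts first from a word [w = w' sigma_(i_1)] changes
    [varpi_k - w varpi_k] by [w' alpha_k = beta_1] if [i_1 = k] and leaves it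
    unchanged otherwise; the sum telescopes. *)
Require Import Defs.
From mathcomp Require Import all_boot all_order all_algebra.
From mathcomp Require Import finmap sesquilinear reals.
Import GRing.Theory Num.Theory.
Local Open Scope ring_scope.

(** [word_prod] grows on the left, while the telescoping strips the rightmost factor, the letter
    acting first. *)
Lemma word_prod_cons (R : realType) (V : vectType R) (form : {dot V for idfun})
    (r : nat) (alpha : r.-tuple V) (i : 'I_r) (s : seq 'I_r) :
  word_prod form alpha (i :: s)
  = (word_prod form alpha s \o simple_reflection form alpha i)%VF.
Proof.
(* Inserting [\1] to the left of the reflection exposes an accumulator that the induction can
   generalize. *)
rewrite /word_prod /= comp_lfun1r -[X in foldl _ X]comp_lfun1l.
elim: s \1%VF => //= j s IHs w.
by rewrite comp_lfunA IHs.
Qed.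

(** The subtracted coefficient is the pairing of [varpi k] with a simple coroot. *)
Lemma simple_reflection_weight (R : realType) (V : vectType R)
    (form : {dot V for idfun}) (r : nat) (alpha : r.-tuple V)
    (varpi : 'I_r -> V) (i k : 'I_r) :
  fundamental_weights form alpha varpi ->
  simple_reflection form alpha i (varpi k)
  = varpi k - (i == k)%:R *: tnth alpha i.
Proof.
by move=> varpiP; rewrite /simple_reflection reflectionE /cartan varpiP eq_sym.
Qed.

Lemma sum_word_root (R : realType) (V : vectType R) (form : {dot V for idfun})
    (r : nat) (alpha : r.-tuple V) (varpi : 'I_r -> V) (t : nat)
    (s : t.-tuple 'I_r) (k : 'I_r) :
  fundamental_weights form alpha varpi ->
  \sum_(j < t | tnth s j == k) word_root form alpha s j
  = varpi k - word_prod form alpha s (varpi k).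
Proof.
move=> varpiP; elim: t s => [|t IHt] s.
  by rewrite big_ord0 tuple0 /word_prod /= id_lfunE subrr.
case/tupleP: s => i s; rewrite big_mkcond big_ord_recl /= tnth0.
(* A root depends only on its own letter and the later ones, so past the head these are the roots of
   the tail. *)
under eq_bigr => j _ do rewrite tnthS /word_root /= tnthS.
rewrite -big_mkcond /= [X in _ + X]IHt word_prod_cons comp_lfunE.
rewrite simple_reflection_weight // linearB linearZ /= opprB addrCA.
(* Exactly the tail follows position 0, so the head's root is the tail's product applied to
   [tnth alpha i]. *)
congr (_ + _); rewrite /word_root /= tnth0 drop0.
by case: eqP => _; rewrite ?scale1r ?scale0r.
Qed.

Theorem theorem4p2 (R : realType) (V : vectType R) (form : {dot V for idfun})
    (Phi : {fset V}) (r : nat) (alpha : r.-tuple V) (varpi : 'I_r -> V)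
    (w0 : 'End(V)) (t : nat) (s : t.-tuple 'I_r)
    (PhiP : root_system form Phi)
    (Phi_red : reduced_root_system Phi)
    (Phi_irr : irreducible_root_system form Phi)
    (alphaP : simple_roots alpha Phi)
    (varpiP : fundamental_weights form alpha varpi)
    (w0P : longest_element form Phi alpha w0)
    (sP : reduced_expression form alpha w0 s) :
  forall k : 'I_r,
    \sum_(j < t | tnth s j == k) word_root form alpha s j
    = varpi k - w0 (varpi k).
Proof.
by move=> k; case: sP => <- _; apply: sum_word_root.
Qed.
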